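(* Let $r_1,r_2$ be any positive integers. For every $k\ge 1$, both components of the $k$-fold alternating iteration $\underbrace{\cdots K_{r_1}K_{r_2}K_{r_1}}_{k}(x,y)$ of the Kontsevich maps $K_{r_1}$ and $K_{r_2}$ (the rightmost $K_{r_1}$ being applied first, then $K_{r_2}$, then $K_{r_1}$, and so on, $k$ maps in total) are noncommutative Laurent polynomials in $x$ and $y$.
   Context: Let $\mathbb{Q}\langle x^{\pm1},y^{\pm1}\rangle$ be the group algebra over $\mathbb{Q}$ of the free group on two generators $x,y$; its elements are called noncommutative Laurent polynomials in $x$ and $y$. By Malcev, this algebra embeds in a division ring; let $Frac(\mathbb{Q}\langle x^{\pm1},y^{\pm1}\rangle)$ denote the smallest one, i.e. the division subring generated by the image of the algebra. For a positive integer $r$, the Kontsevich map $K_r$ is the birational automorphism of the noncommutative plane given by $K_r:(x,y)\mapsto (xyx^{-1},(1+y^r)x^{-1})$; it is applied to pairs $(a,b)$ of elements of the division ring by $K_r(a,b)=(aba^{-1},(1+b^r)a^{-1})$. Thus the $k$-fold iteration is the pair obtained from $(x,y)$ by applying successively $K_{r_1},K_{r_2},K_{r_1},\dots$ ($k$ maps). *)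

(* Defs.v *)
From HB Require Import structures.
From mathcomp Require Import all_boot all_order all_algebra.
From mathcomp Require Import finmap.
From mathcomp.multinomials Require Import monalg.

Set Implicit Arguments.
Unset Strict Implicit.
Unset Printing Implicit Defensive.

Import GRing.Theory.

(* The free group on X: reduced words in the letters (i, false), standing for
   the generator i, and (i, true), standing for its inverse. *)
Section FreeGroup.
Variable X : choiceType.

Definition letter := (X * bool)%type.
Implicit Types (l m : letter) (u v w : seq letter).

Definition letter_inv l : letter := (l.1, ~~ l.2).

Definition reduced w := sorted (fun l m => m != letter_inv l) w.

Definition push l w :=
  if w is m :: w' then if m == letter_inv l then w' else l :: w else [:: l].

Definition word_mul u v := foldr push v u.

Definition word_inv w := rev (map letter_inv w).

Record freegroup : predArgType :=
  FreeGroup { word : seq letter; word_reduced : reduced word }.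

HB.instance Definition _ := [isSub for word].
HB.instance Definition _ := [Choice of freegroup by <:].

Lemma letter_invK : involutive letter_inv.
Proof. by case=> i b; rewrite /letter_inv /= negbK. Qed.

Lemma reduced_push l w : reduced w -> reduced (push l w).
Proof.
case: w => [//|m w]; rewrite /push; case: ifPn => [_ /path_sorted //|ne].
by rewrite /reduced /= ne.
Qed.

Lemma reduced_mul u v : reduced v -> reduced (word_mul u v).
Proof. by move=> rv; elim: u => //= l u; apply: reduced_push. Qed.

Lemma reduced_inv w : reduced w -> reduced (word_inv w).
Proof.
rewrite /reduced /word_inv rev_sorted sorted_map.
by apply: sub_sorted => l m /=; rewrite letter_invK eq_sym.
Qed.

Lemma pushK l w : reduced w -> push l (push (letter_inv l) w) = w.
Proof.
case: w => [_|m w] /=; first by rewrite eqxx.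
rewrite letter_invK; case: (altP (m =P l)) => [-> | ne _].
  by case: w => [|m' w] //= /andP[/negbTE->].
by rewrite /push eqxx.
Qed.

Lemma push_mul l v w :
  reduced w -> word_mul (push l v) w = push l (word_mul v w).
Proof.
move=> rw; case: v => [//|m v] /=; case: eqP => // ->.
by rewrite pushK // reduced_mul.
Qed.

Lemma word_mulA u v w :
  reduced w -> word_mul u (word_mul v w) = word_mul (word_mul u v) w.
Proof. by move=> rw; elim: u => //= l u ->; rewrite push_mul. Qed.

Lemma word_mul1 w : reduced w -> word_mul w [::] = w.
Proof.
elim: w => //= l w IH lw; have rw : reduced w := path_sorted lw.
rewrite IH //; case: w lw {IH rw} => //= m w /andP[/negbTE-> _] //.
Qed.

Lemma word_mulV w : word_mul w (word_inv w) = [::].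
Proof.
suff H v : word_mul w (word_inv w ++ v) = v by rewrite -[word_inv w]cats0 H.
elim: w v => //= l w IH v.
by rewrite /word_inv /= rev_cons cat_rcons IH /= eqxx.
Qed.

Lemma word_invK : involutive word_inv.
Proof.
by move=> w; rewrite /word_inv map_rev revK -map_comp map_id_in // => l _ /=;
  rewrite letter_invK.
Qed.

Definition freegroup1 : freegroup := @FreeGroup [::] isT.
Definition freegroup_mul (a b : freegroup) : freegroup :=
  FreeGroup (reduced_mul (word a) (word_reduced b)).
Definition freegroup_inv (a : freegroup) : freegroup :=
  FreeGroup (reduced_inv (word_reduced a)).

Lemma freegroup_mulA : associative freegroup_mul.
Proof.
by move=> a b c; apply: val_inj => /=; apply: word_mulA (word_reduced c).
Qed.

Lemma freegroup_mul1g : left_id freegroup1 freegroup_mul.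
Proof. by move=> a; apply: val_inj. Qed.

Lemma freegroup_mulg1 : right_id freegroup1 freegroup_mul.
Proof. by move=> a; apply: val_inj; apply: word_mul1 (word_reduced a). Qed.

Lemma freegroup_mulVg : left_inverse freegroup1 freegroup_inv freegroup_mul.
Proof.
by move=> a; apply: val_inj => /=; rewrite -{2}[word a]word_invK word_mulV.
Qed.

Lemma freegroup_mulgV : right_inverse freegroup1 freegroup_inv freegroup_mul.
Proof. by move=> a; apply: val_inj; apply: word_mulV. Qed.

HB.instance Definition _ := isGroup.Build freegroup
  freegroup_mulA freegroup_mul1g freegroup_mulg1
  freegroup_mulVg freegroup_mulgV.

Definition generator (i : X) : freegroup := @FreeGroup [:: (i, false)] isT.

End FreeGroup.

Local Open Scope ring_scope.

(* {malg R[G]} is the R-module of finitely supported functions G -> R; its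
   library product is only available for monomial monoids, which have no
   nontrivial unit, whence this alias, which carries the convolution product. *)
Definition group_algebra (R : nzRingType) (G : groupType) := {malg R[G]}.

(* Locked because unification of closed terms of the group algebra of a free
   group is intractable otherwise. *)
HB.lock Definition galg_elt (R : nzRingType) (G : groupType) (k : G) :
  group_algebra R G := << 1 *g k >>.
Arguments galg_elt R {G} k.
Canonical galg_elt_unlock := Unlockable galg_elt.unlock.

HB.lock Definition galg_mul (R : nzRingType) (G : groupType)
    (g1 g2 : group_algebra R G) : group_algebra R G :=
  \sum_(k1 <- msupp g1) \sum_(k2 <- msupp g2)
    << g1@_k1 * g2@_k2 *g (k1 * k2)%g >>.
Arguments galg_mul {R G} g1 g2.
Canonical galg_mul_unlock := Unlockable galg_mul.unlock.

Section GroupAlgebra.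
Variables (R : nzRingType) (G : groupType).

HB.instance Definition _ := GRing.Lmodule.on (group_algebra R G).

Implicit Types g : group_algebra R G.
Local Notation galg_elt := (@galg_elt R G).
Local Notation galg_mul := (@galg_mul R G).

Local Open Scope fset_scope.

Lemma galg_mulE g1 g2 :
  galg_mul g1 g2 = \sum_(k1 <- msupp g1) \sum_(k2 <- msupp g2)
    << g1@_k1 * g2@_k2 *g (k1 * k2)%g >>.
Proof. by rewrite galg_mul.unlock. Qed.

Lemma galg_mullw (d1 d2 : {fset G}) g1 g2 :
  msupp g1 `<=` d1 -> msupp g2 `<=` d2 ->
  galg_mul g1 g2 =
    \sum_(k1 <- d1) \sum_(k2 <- d2) << g1@_k1 * g2@_k2 *g (k1 * k2)%g >>.
Proof.
move=> le_d1 le_d2; rewrite galg_mulE (big_fset_incl _ le_d1) /=.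
  apply/eq_bigr=> k1 _; apply/big_fset_incl => // k _ /mcoeff_outdom ->.
  by rewrite mulr0 monalgU0.
move=> k _ /mcoeff_outdom g1k.
by rewrite big1 => // k' _; rewrite g1k mul0r monalgU0.
Qed.

Lemma galg_mulrw (d1 d2 : {fset G}) g1 g2 :
  msupp g1 `<=` d1 -> msupp g2 `<=` d2 ->
  galg_mul g1 g2 =
    \sum_(k2 <- d2) \sum_(k1 <- d1) << g1@_k1 * g2@_k2 *g (k1 * k2)%g >>.
Proof. by move=> le_d1 le_d2; rewrite (galg_mullw le_d1 le_d2) exchange_big. Qed.

Lemma galg_mul0g : left_zero 0 galg_mul.
Proof. by move=> g; rewrite galg_mulE msupp0 big_seq_fset0. Qed.

Lemma galg_mulg0 : right_zero 0 galg_mul.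
Proof.
by move=> g; rewrite galg_mulE exchange_big msupp0 big_seq_fset0.
Qed.

Lemma galg_mulUg c (k : G) g :
  galg_mul << c *g k >> g = \sum_(k' <- msupp g) << c * g@_k' *g (k * k')%g >>.
Proof.
rewrite (galg_mullw msuppU_le (fsubset_refl _)) big_seq_fset1.
by apply/eq_bigr => k' _; rewrite mcoeffUU.
Qed.

Lemma galg_mulgU c (k : G) g :
  galg_mul g << c *g k >> = \sum_(k' <- msupp g) << g@_k' * c *g (k' * k)%g >>.
Proof.
rewrite (galg_mulrw (fsubset_refl _) msuppU_le) big_seq_fset1.
by apply/eq_bigr=> k' _; rewrite mcoeffUU.
Qed.

Lemma galg_mulUU c1 c2 (k1 k2 : G) :
  galg_mul << c1 *g k1 >> << c2 *g k2 >> = << c1 * c2 *g (k1 * k2)%g >>.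
Proof. by rewrite (galg_mulrw msuppU_le msuppU_le) !big_seq_fset1 !mcoeffUU. Qed.

Lemma galg_mulEl g1 g2 :
  galg_mul g1 g2 = \sum_(k1 <- msupp g1) galg_mul << g1@_k1 *g k1 >> g2.
Proof.
by rewrite [LHS]galg_mulE; apply/eq_bigr=> k _; rewrite galg_mulUg.
Qed.

Lemma galg_mulEr g1 g2 :
  galg_mul g1 g2 = \sum_(k2 <- msupp g2) galg_mul g1 << g2@_k2 *g k2 >>.
Proof.
rewrite [LHS]galg_mulE exchange_big /=; apply/eq_bigr=> k _.
by rewrite galg_mulgU.
Qed.

Lemma galg_mul1g : left_id (galg_elt 1%g) galg_mul.
Proof.
move=> g; rewrite galg_elt.unlock galg_mulUg [RHS]monalgE.
by apply/eq_bigr=> k _; rewrite mul1r mul1g.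
Qed.

Lemma galg_mulg1 : right_id (galg_elt 1%g) galg_mul.
Proof.
move=> g; rewrite galg_elt.unlock galg_mulgU [RHS]monalgE.
by apply/eq_bigr=> k _; rewrite mulr1 mulg1.
Qed.

Lemma galg_mulDl : left_distributive galg_mul +%R.
Proof.
move=> g1 g2 g.
have sb := fsubset_refl (msupp g).
rewrite [in RHS](galg_mullw (fsubsetUl _ (msupp g2)) sb).
rewrite [in RHS](galg_mullw (fsubsetUr (msupp g1) _) sb).
rewrite (galg_mullw (msuppD_le _ _) sb).
rewrite -big_split /=; apply/eq_bigr=> k1 _.
rewrite -big_split /=; apply/eq_bigr=> k2 _.
by rewrite mcoeffD mulrDl monalgUD.
Qed.

Lemma galg_mulDr : right_distributive galg_mul +%R.
Proof.
move=> g g1 g2.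
have sb := fsubset_refl (msupp g).
rewrite [in RHS](galg_mullw sb (fsubsetUl _ (msupp g2))).
rewrite [in RHS](galg_mullw sb (fsubsetUr (msupp g1) _)).
rewrite (galg_mullw sb (msuppD_le _ _)).
rewrite -big_split /=; apply/eq_bigr => k1 _.
rewrite -big_split /=; apply/eq_bigr => k2 _.
by rewrite mcoeffD mulrDr monalgUD.
Qed.

Lemma galg_mulA : associative galg_mul.
Proof.
have sumDl g r (F : G -> {malg R[G]}) :
    galg_mul (\sum_(k <- r) F k) g = \sum_(k <- r) galg_mul (F k) g.
  apply: (big_morph (galg_mul^~ g)) => [x y|]; first exact: galg_mulDl.
  exact: galg_mul0g.
have sumDr g r (F : G -> {malg R[G]}) :
    galg_mul g (\sum_(k <- r) F k) = \sum_(k <- r) galg_mul g (F k).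
  apply: (big_morph (galg_mul g)) => [x y|]; first exact: galg_mulDr.
  exact: galg_mulg0.
move=> g1 g2 g3; rewrite [LHS]galg_mulEl (galg_mulE g1 g2) sumDl.
apply/eq_bigr=> k1 _; rewrite (galg_mulE g2 g3) sumDr sumDl.
apply/eq_bigr=> k2 _; rewrite sumDr galg_mulEr.
by apply/eq_bigr=> k3 _; rewrite !galg_mulUU mulrA mulgA.
Qed.

Lemma galg_elt1_neq0 : galg_elt 1%g != 0.
Proof. by rewrite galg_elt.unlock monalgU_eq0 oner_eq0. Qed.

HB.instance Definition _ := GRing.Zmodule_isNzRing.Build (group_algebra R G)
  galg_mulA galg_mul1g galg_mulg1 galg_mulDl galg_mulDr galg_elt1_neq0.

Lemma galg_scaleAl c g1 g2 : c *: (g1 * g2) = (c *: g1) * g2.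
Proof.
have Z g : c *: g = galg_mul << c *g 1%g >> g.
  by rewrite galg_mulUg; apply/eq_bigr => k _; rewrite mul1g.
by rewrite !Z galg_mulA.
Qed.

HB.instance Definition _ :=
  GRing.Lmodule_isLalgebra.Build R (group_algebra R G) galg_scaleAl.

End GroupAlgebra.

Section GroupAlgebraCom.
Variables (R : comNzRingType) (G : groupType).

Lemma galg_scaleAr c (g1 g2 : group_algebra R G) :
  c *: (g1 * g2) = g1 * (c *: g2).
Proof.
have Z (g : group_algebra R G) : c *: g = g * << c *g 1%g >>.
  rewrite [RHS]galg_mulgU; apply/eq_bigr => k _.
  by rewrite mulg1 mulrC.
by rewrite !Z mulrA.
Qed.

HB.instance Definition _ :=
  GRing.Lalgebra_isAlgebra.Build R (group_algebra R G) galg_scaleAr.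

End GroupAlgebraCom.

Notation ncLaurent := (group_algebra rat (freegroup 'I_2)).

Definition ncx : ncLaurent := galg_elt rat (generator ord0).
Definition ncy : ncLaurent := galg_elt rat (generator ord_max).

Inductive division_closure (A : nzRingType) (D : unitRingType) (f : A -> D) :
    D -> Prop :=
| division_closure_image a : division_closure f (f a)
| division_closure_sub u v :
    division_closure f u -> division_closure f v -> division_closure f (u - v)
| division_closure_mul u v :
    division_closure f u -> division_closure f v -> division_closure f (u * v)
| division_closure_inv u : division_closure f u -> division_closure f u^-1.

(* D, together with f, is a division ring containing A and generated by it.
   For noncommutative A such a D need not be unique up to isomorphism over A.
   GRing.field_axiom does not involve commutativity. *)
Definition is_skew_fraction_field (A : nzRingType) (D : unitRingType)
    (f : {rmorphism A -> D}) :=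
  [/\ GRing.field_axiom D, injective f & forall u : D, division_closure f u].

(* K_r is only a rational map: it is undefined (None) where its first
   argument is not invertible. *)
Definition kontsevich (D : unitRingType) (r : nat) (ab : D * D) :
    option (D * D) :=
  let: (a, b) := ab in
  if a \is a GRing.unit
  then Some (a * b * a^-1, (1 + b ^+ r) * a^-1) else None.

(* The k-th map applied is K_{r1} for odd k and K_{r2} for even k. *)
Fixpoint kontsevich_iter (D : unitRingType) (r1 r2 k : nat) (ab : D * D) :
    option (D * D) :=
  if k is k'.+1
  then obind (kontsevich (if odd k then r1 else r2))
             (kontsevich_iter r1 r2 k' ab)
  else Some ab.

(* Main.v *)
(* The commutator c = x y x^-1 y^-1 is preserved by every K_r, so the k-th
   iterate can be written (c y_k, y_(k+1)), where the y_k satisfy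
     y_k y_(k+1) = y_(k+1) c y_k   and   y_(k+2) c y_k = 1 + y_(k+1)^r,
   with r alternating between r1 and r2.  As for commutative cluster algebras
   of rank 2, y_(k+4) is a polynomial in c, c^-1 and y_k, ..., y_(k+3), so all
   y_k lie in the Laurent ring as soon as the first four do.  The y_k are
   nonzero because the recurrence makes their augmentations (sums of
   coefficients) positive. *)

Require Import Defs.
From HB Require Import structures.
From mathcomp Require Import all_boot all_order all_algebra.
From mathcomp Require Import finmap.
From mathcomp.multinomials Require Import monalg.

Set Implicit Arguments.
Unset Strict Implicit.

Import Order.TTheory GRing.Theory Num.Theory.
Local Open Scope ring_scope.

Lemma galg_eltM (R : nzRingType) (G : groupType) (g h : G) :
  galg_elt R g * galg_elt R h = galg_elt R (g * h)%g.
Proof. by rewrite galg_elt.unlock [LHS]galg_mulUU mulr1. Qed.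

Definition augmentation (R : nzRingType) (G : groupType)
  (g : group_algebra R G) : R := \sum_(k <- msupp g) g@_k.

Section Augmentation.
Variables (R : nzRingType) (G : groupType).
Implicit Types g h : group_algebra R G.
Local Notation augmentation := (@augmentation R G).
Local Open Scope fset_scope.

Lemma augmentationEw (d : {fset G}) g :
  msupp g `<=` d -> augmentation g = \sum_(k <- d) g@_k.
Proof.
move=> le_gd; rewrite [LHS](big_fset_incl _ le_gd) // => k _.
exact: mcoeff_outdom.
Qed.

Lemma augmentation_is_zmod_morphism : zmod_morphism augmentation.
Proof.
move=> g h; set d := msupp g `|` msupp h.
have le_g : msupp g `<=` d := fsubsetUl _ _.
have le_h : msupp h `<=` d := fsubsetUr _ _.
rewrite (augmentationEw le_g) (augmentationEw le_h).
rewrite (augmentationEw (msuppB_le _ _)) -sumrB.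
by apply: eq_bigr => k _; rewrite mcoeffB.
Qed.

HB.instance Definition _ := GRing.isZmodMorphism.Build _ _ augmentation
  augmentation_is_zmod_morphism.

Lemma augmentationU (c : R) (k : G) : augmentation << c *g k >> = c.
Proof. by rewrite (augmentationEw msuppU_le) big_seq_fset1 mcoeffUU. Qed.

Lemma augmentation_elt (k : G) : augmentation (galg_elt R k) = 1.
Proof. by rewrite galg_elt.unlock augmentationU. Qed.

Lemma augmentation_is_monoid_morphism : monoid_morphism augmentation.
Proof.
split=> [|g h]; first exact: augmentation_elt.
rewrite [g * h]galg_mulE raddf_sum /= [RHS]mulr_suml.
apply: eq_bigr => k _; rewrite raddf_sum /= mulr_sumr.
by apply: eq_bigr => l _; rewrite augmentationU.
Qed.

HB.instance Definition _ := GRing.isMonoidMorphism.Build _ _ augmentation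
  augmentation_is_monoid_morphism.

End Augmentation.

Section Exchange.
Variable A : nzRingType.
Implicit Types a b c u v w z : A.

Lemma conj_exp b v w n : w * v = b * w -> w * v ^+ n = b ^+ n * w.
Proof.
move=> wv; elim: n => [|n IH]; first by rewrite mulr1 mul1r.
by rewrite exprS mulrA wv -mulrA IH mulrA -exprS.
Qed.

(** Modulo the left ideal [A * w] the product [u * v] is 1, and [w * v = b * w] makes this ideal
    stable under right multiplication by [v]; the inner products [u * v] thus collapse one at a
    time. *)
Lemma exp_mul_exp_left_ideal b u v w s n :
    w * v = b * w -> u * v = 1 + w ^+ s.+1 ->
  exists e, u ^+ n * v ^+ n = 1 + e * w.
Proof.
move=> wv uv; elim: n => [|n [e IH]].
  by exists 0; rewrite mul0r addr0 mulr1.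
exists (e + u ^+ n * w ^+ s * b ^+ n).
rewrite exprSr exprS !mulrA -(mulrA _ u) uv mulrDr mulr1 mulrDl IH.
by rewrite exprSr !mulrA -(mulrA _ w) (conj_exp _ wv) mulrDl !mulrA addrA.
Qed.

Lemma exchange_quotient c c' a b w u s n :
    c' * c = 1 -> GRing.lreg w -> b * w = w * c * b ->
    w * c * a = 1 + b ^+ n -> u * c * b = 1 + w ^+ s.+1 ->
  exists z, z * c * w = 1 + u ^+ n.
Proof.
(* With [v = c * b], the witness is [(u ^+ n * c * a - e) * c'] because
   [c * a * w = 1 + v ^+ n] and [u ^+ n * v ^+ n = 1 + e * w]. *)
move=> c'c reg_w bw wca ucb.
have wv : w * (c * b) = b * w by rewrite mulrA -bw.
have [e ue] := exp_mul_exp_left_ideal n wv (etrans (mulrA _ _ _) ucb).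
have caw : c * a * w = 1 + (c * b) ^+ n.
  (* Left cancellation of [w]: [w * c * a * w = (1 + b ^+ n) * w], and moving [w] to the left turns
     [b] into [c * b]. *)
  apply: reg_w.
  by rewrite !mulrA wca mulrDl mulrDr mul1r mulr1 (conj_exp _ wv).
exists ((u ^+ n * (c * a) - e) * c').
rewrite -(mulrA _ c') c'c mulr1 mulrBl -mulrA caw mulrDr mulr1 ue.
by rewrite addrA addrK addrC.
Qed.

(** After right multiplication by the regular element [c * b], both sides become [w + w ^+ m.+1], as
    [w * c * b = b * w]. *)
Lemma exchange_twisted_comm c c' b w u m :
    c' * c = 1 -> c * c' = 1 -> GRing.rreg b -> b * w = w * c * b ->
    u * c * b = 1 + w ^+ m ->
  w * u = u * c * w.
Proof.
move=> c'c cc' reg_b bw ucb.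
have reg_c : GRing.rreg c.
  by apply: (can_inj (g := *%R^~ c')) => z; rewrite -mulrA cc' mulr1.
apply: (rregM reg_c reg_b).
rewrite -!mulrA (mulrA u) ucb (mulrA w c b) -bw !mulrA ucb.
by rewrite mulrDr mulrDl mulr1 mul1r -exprS -exprSr.
Qed.

End Exchange.

(** Conjugation by [c * a] takes [b] to [c * b], so a Kontsevich map only shifts the index of the
    sequence. *)
Lemma kontsevich_twisted_comm (D : unitRingType) (c a b : D) (r : nat) :
    c * a \is a GRing.unit -> a * b = b * c * a ->
  kontsevich r (c * a, b) = Some (c * b, (1 + b ^+ r) * (c * a)^-1).
Proof.
move=> ca_unit ab; rewrite /kontsevich ca_unit.
by rewrite -(mulrA c a b) ab -(mulrA b) (mulrA c b) mulrK.
Qed.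

Lemma augmentation_gt0_unit (R : numDomainType) (G : groupType)
    (D : unitRingType) (iota : {rmorphism group_algebra R G -> D})
    (p : group_algebra R G) :
    GRing.field_axiom D -> injective iota -> 0 < augmentation p ->
  iota p \is a GRing.unit.
Proof.
move=> fieldD inj_iota p_gt0; apply: fieldD.
rewrite -(rmorph0 iota) (inj_eq inj_iota).
by apply: contraTneq p_gt0 => ->; rewrite raddf0 ltxx.
Qed.

Lemma augmentation_gt0_exchange (R : numDomainType) (G : groupType)
    (a b c w : group_algebra R G) (n : nat) :
    0 < augmentation a -> 0 < augmentation b -> 0 < augmentation c ->
    w * c * a = 1 + b ^+ n ->
  0 < augmentation w.
Proof.
move=> a_gt0 b_gt0 c_gt0 /(congr1 (@augmentation _ _)).
rewrite !rmorphM rmorphD rmorph1 rmorphXn => wca.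
have : 0 < augmentation w * augmentation c * augmentation a.
  by rewrite wca ltr_wpDr ?ltr01 // ltW ?exprn_gt0.
by rewrite -mulrA pmulr_lgt0 // mulr_gt0.
Qed.

Local Notation monomial g := (galg_elt rat g).
Local Notation gx := (@generator 'I_2 ord0).
Local Notation gy := (@generator 'I_2 ord_max).
Local Notation gc := (gx * gy * gx^-1 * gy^-1)%g.
Local Notation c := (monomial gc).
Local Notation exponent r1 r2 k := (if odd k then r1 else r2).

(** Here [a], [b], [w], [u] are y_k, ..., y_(k+3). The induction carries four terms because
    [exchange_quotient] builds the next one from them. *)
Lemma kontsevich_iter_exchange (D : unitRingType)
    (iota : {rmorphism ncLaurent -> D}) (r1 r2 k : nat) :
    GRing.field_axiom D -> injective iota -> (0 < r1)%N -> (0 < r2)%N ->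
  exists a b w u : ncLaurent,
    [/\ kontsevich_iter r1 r2 k (iota ncx, iota ncy)
          = Some (iota c * iota a, iota b),
        [/\ a * b = b * c * a, b * w = w * c * b & w * u = u * c * w],
        w * c * a = 1 + b ^+ exponent r1 r2 k.+1,
        u * c * b = 1 + w ^+ exponent r1 r2 k.+2
      & [/\ 0 < augmentation a, 0 < augmentation b,
            0 < augmentation w & 0 < augmentation u]].
Proof.
move=> fieldD inj_iota r1_gt0 r2_gt0.
have cc' : c * monomial gc^-1 = 1 by rewrite galg_eltM mulgV.
have c'c : monomial gc^-1 * c = 1 by rewrite galg_eltM mulVg.
have c_gt0 : 0 < augmentation c by rewrite augmentation_elt ltr01.
have unit_iota (p : ncLaurent) : 0 < augmentation p -> iota p \is a GRing.unit.
  exact: augmentation_gt0_unit.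
(* Cancellation is pulled back along [iota] from [D], where these elements are units. *)
have reg (p : ncLaurent) : 0 < augmentation p -> GRing.lreg p /\ GRing.rreg p.
  move=> p_gt0; have up := unit_iota p p_gt0;
  split=> q q' /(congr1 iota); rewrite !rmorphM.
    by move/(mulrI up)/inj_iota.
  by move/(mulIr up)/inj_iota.
elim: k => [|k [a [b [w [u
  [iterE [ab bw wu] wca ucb [a_gt0 b_gt0 w_gt0 u_gt0]]]]]]].
  (* [a] is chosen so that [c * a] is x; [w] and [u] solve the exchange relations by inverting the
     monomials [c * a] and [c * b]. *)
  pose a : ncLaurent := monomial (gc^-1 * gx)%g.
  pose b : ncLaurent := monomial gy.
  pose w : ncLaurent := (1 + b ^+ r1) * monomial gx^-1%g.
  pose u : ncLaurent := (1 + w ^+ r2) * monomial (gc * gy)^-1%g.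
  have a_gt0 : 0 < augmentation a by rewrite augmentation_elt ltr01.
  have b_gt0 : 0 < augmentation b by rewrite augmentation_elt ltr01.
  have ab : a * b = b * c * a.
    rewrite /a /b !galg_eltM -[in RHS]mulgA mulVKg.
    by rewrite !invgM !invgK -!mulgA mulKg mulVg mulg1.
  have wca : w * c * a = 1 + b ^+ r1.
    by rewrite /w /a -!mulrA !galg_eltM mulVKg mulVg mulr1.
  have bw : b * w = w * c * b.
    by apply: exchange_twisted_comm c'c cc' _ ab wca; case: (reg a a_gt0).
  have ucb : u * c * b = 1 + w ^+ r2.
    by rewrite /u /b -!mulrA !galg_eltM mulVg mulr1.
  have wu : w * u = u * c * w.
    by apply: exchange_twisted_comm c'c cc' _ bw ucb; case: (reg b b_gt0).
  have w_gt0 := augmentation_gt0_exchange a_gt0 b_gt0 c_gt0 wca.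
  have u_gt0 := augmentation_gt0_exchange b_gt0 w_gt0 c_gt0 ucb.
  exists a, b, w, u; split=> //=.
  by rewrite -rmorphM /a galg_eltM mulVKg.
(* Positivity of [r1] and [r2] enters here: [exchange_quotient] needs a nonzero power of [w]. *)
have [s sE] : exists s, exponent r1 r2 k.+2 = s.+1.
  by case: ifP => _; [exists r1.-1 | exists r2.-1]; rewrite prednK.
have [lreg_w _] := reg w w_gt0; have [_ rreg_b] := reg b b_gt0.
have [_ rreg_w] := reg w w_gt0.
rewrite sE in ucb.
have [z zcw] := exchange_quotient c'c lreg_w bw wca ucb.
have uz := exchange_twisted_comm c'c cc' rreg_w wu zcw.
exists b, w, u, z; split=> //; last 2 first.
(* The exponents have period two, so the one for [k.+3] is the one for [k.+1]. *)
- by rewrite zcw /= negbK.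
- split=> //; exact: augmentation_gt0_exchange w_gt0 u_gt0 c_gt0 zcw.
- have ca_unit : iota c * iota a \is a GRing.unit.
    by rewrite -rmorphM; apply: unit_iota; rewrite rmorphM mulr_gt0.
  rewrite /kontsevich_iter -/(kontsevich_iter r1 r2 k _) iterE.
  apply: etrans (kontsevich_twisted_comm _ ca_unit _) _.
    by rewrite -!rmorphM ab.
  (* Clearing the denominator [c * a] leaves the relation [wca]. *)
  congr (Some (_, _)); apply: (mulIr ca_unit); rewrite mulrVK //.
  by rewrite -!rmorphM -rmorphXn -(rmorph1 iota) -rmorphD mulrA wca.
- by rewrite sE.
Qed.

Theorem theorem2 (D : unitRingType) (iota : {rmorphism ncLaurent -> D})
    (hD : is_skew_fraction_field iota)
    (r1 r2 : nat) (hr1 : (0 < r1)%N) (hr2 : (0 < r2)%N)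
    (k : nat) (hk : (1 <= k)%N) :
  exists p q : ncLaurent,
    kontsevich_iter r1 r2 k (iota ncx, iota ncy) = Some (iota p, iota q).
Proof.
have [fieldD inj_iota _] := hD.
have [a [b [w [u [iterE _ _ _ _]]]]] :=
  kontsevich_iter_exchange k fieldD inj_iota hr1 hr2.
by exists (c * a), b; rewrite rmorphM.
Qed.
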